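(* Any $(5,5)$-product in $\mathbb{R}^4$ has two triangles which have disjoint vertex sets but intersect.
   Context: Let $m,n\ge 2$ be integers, $[n]:=\{1,2,\ldots,n\}$, and let $A_{jp}$, $j\in[m]$, $p\in[n]$, be $mn$ pairwise distinct points in $\mathbb{R}^d$ (here $d=4$). For $j,k\in[m]$ with $j<k$ and $p,q\in[n]$ with $p<q$ denote $$jk\times pq:=\{A_{jp}A_{kq}A_{jq},\ A_{jp}A_{kq}A_{kp}\},$$ a pair of triangles having the common side $A_{jp}A_{kq}$. The $(m,n)$-product (corresponding to the points $A_{jp}$) is the collection of all triangles from $jk\times pq$, where $1\le j<k\le m$, $1\le p<q\le n$. A triangle is the convex hull of its three vertices. Two triangles intersect if they have at least one common point. The points $A_{jp}$ are not assumed to be in general position. *)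

(* Defs.v *)
From mathcomp Require Import all_boot all_order all_algebra.
From mathcomp Require Import classical_sets reals convex.

Set Implicit Arguments.
Unset Strict Implicit.
Unset Printing Implicit Defensive.

Local Open Scope classical_set_scope.
Local Open Scope ring_scope.

Definition convex_hull (R : realType) (d : nat) (V : set 'rV[R]_d) :
    set 'rV[R]_d :=
  smallest [set C | @convex_set R 'rV[R]_d C] V.

(* Triangles are represented by their vertex sets, since a degenerate triangle
   does not determine its vertices; the triangle itself is [convex_hull V]. *)
Definition triangle_pair (R : realType) (d m n : nat)
    (A : 'I_m -> 'I_n -> 'rV[R]_d) (j k : 'I_m) (p q : 'I_n) :
    set (set 'rV[R]_d) :=
  [set [set A j p; A k q; A j q]; [set A j p; A k q; A k p]].

Definition mn_product (R : realType) (d m n : nat)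
    (A : 'I_m -> 'I_n -> 'rV[R]_d) : set (set 'rV[R]_d) :=
  [set V | exists (j k : 'I_m) (p q : 'I_n),
     [/\ (j < k)%N, (p < q)%N & triangle_pair A j k p q V]].

(* Main.v *)
Require Import Defs.
From mathcomp Require Import all_boot all_order all_algebra.
From mathcomp Require Import ring interval_inference.
From mathcomp Require Import boolp classical_sets reals convex.

(** The obstruction is the van Kampen number: in general position, the number
    of crossing pairs of vertex-disjoint triangles, taken over a suitable list
    of pairs of triangles of the product, is odd.

    Homogenize the points to vectors of R^5.  A cell (s, t) consists of two
    disjoint lists of labels, and it is crossed ([crosses]) when the hulls of
    the points of s and of t meet in their relative interiors, that is, when
    some linear dependency of the vectors is positive on s and negative on t.
    In general position the crossings of cells obey two laws modulo 2:
    - among the 32 splittings of six points into two parts exactly one is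
      crossed, by Radon's theorem and the uniqueness of the dependency
      ([radon_odd]);
    - a cell with seven labels has an even number of crossed faces, since the
      dependencies with the prescribed signs form a pointed cone in a plane,
      which is trivial or has two extreme rays ([boundary_even]).
    Hence a list of cells homologous modulo 2 to the Radon splittings of six
    points has an odd number of crossed cells.

    It remains to find such a list among the products of triangles of the
    (5,5)-product.  With rows and columns numbered from 0, the triangles at
    the vertex O in row 0 and column 4 are the {A_0p, A_k4, O}, so the link of
    O is the bipartite graph K_{4,4} on the rest of row 0 and the rest of
    column 4.  A pair of disjoint 4-cycles of this graph spans two tori of the
    product, T1 and T2, which share only O.  Write T = D + E, where D is the
    star of O, and let F be a disc that fills the 4-cycle bounding D by two
    triangles on its own four vertices.  Write <X, Y> for the list of cells
    (s, t) with s in X and t in Y.  As E1 + F1 is a cycle vertex-disjoint from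
    the cycle T2, and D1 + F1 is one vertex-disjoint from the cycle E2 + F2,
    both <E1 + F1, T2> and <D1 + F1, E2 + F2> are boundaries, and modulo 2
    their sum is
      (<E1, T2> + <D1, E2>) + (<F1, D2> + <D1, F2> + <F1, F2>).
    The first bracket lives in the product.  Summed over the nine pairs of
    4-cycles that separate A_00 from A_44, the second one becomes the list of
    all pairs of disjoint transversal triangles of the three triples
      {O, A_00, A_44}, {A_01, A_02, A_03}, {A_14, A_24, A_34}.
    Counting each pair in both orders, these pairs form a join of three
    hexagons, one for each triple; each hexagon is homologous to a square that
    involves only two points of the triple, and the join of three squares lists
    the splittings of six points.
    The explicit homology is checked by evaluation
    ([product_homologous_radon]).

    An arbitrary configuration is moved towards the moment curve.  By
    compactness, disjoint hulls stay disjoint for a short while, and at all but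
    finitely many times the points are in general position
    ([touching_of_generic_crossing]). *)

Set Implicit Arguments.
Unset Strict Implicit.
Unset Printing Implicit Defensive.

Import Order.TTheory GRing.Theory Num.Theory.

Local Open Scope classical_set_scope.
Local Open Scope ring_scope.

(** * Extreme elements of a planar sign pattern *)

Lemma addb_unique (T : eqType) (P : pred T) (z : seq T) :
  uniq z -> {in z &, forall i j, P i -> P j -> i = j} ->
  \big[addb/false]_(i <- z) P i = has P z.
Proof.
elim: z => [|x z IH] /=; first by rewrite big_nil.
case/andP=> xz uz Pu; rewrite big_cons IH //; last first.
  by move=> i j iz jz; apply: Pu; rewrite inE ?iz ?jz orbT.
case Px: (P x) => //=; apply/negbT/hasP => -[y yz Py].
have /eqP xy : x = y by apply: Pu; rewrite ?inE ?eqxx ?yz ?orbT.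
by move: xz; rewrite (eqP xy) yz.
Qed.

Definition source (R : realDomainType) (T : eqType) (z : seq T)
    (D : T -> T -> R) (i : T) :=
  all (fun j => (j == i) || (0 < D i j)) z.

Definition sink (R : realDomainType) (T : eqType) (z : seq T)
    (D : T -> T -> R) (i : T) :=
  all (fun j => (j == i) || (0 < D j i)) z.

Lemma source_unique (R : realDomainType) (T : eqType) (z : seq T)
    (D : T -> T -> R) : (forall i j, D j i = - D i j) ->
  {in z &, forall i j, source z D i -> source z D j -> i = j}.
Proof.
move=> DN i j iz jz /allP/(_ _ jz)/= Pij /allP/(_ _ iz)/= Pji.
case: eqVneq Pij => [//|ji /=]; case: eqVneq Pji => [//|ij /=].
by rewrite DN oppr_gt0 => /ltW; rewrite leNgt => /negP.
Qed.

Lemma exists_last (T : eqType) (r : rel T) (z : seq T) : z != [::] ->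
  {in z &, forall i j, i != j -> r i j || r j i} ->
  {in z & & , forall j i k, r i j -> r j k -> r i k} ->
  exists2 k, k \in z & {in z, forall j, j != k -> r j k}.
Proof.
elim: z => [//|x z IH] _ tot tr.
have sub y : y \in z -> y \in x :: z by rewrite inE orbC => ->.
have xin : x \in x :: z by rewrite inE eqxx.
case: (eqVneq z [::]) => [->|z0].
  by exists x; rewrite ?inE // => j; rewrite inE => ->.
have [||k kz last_k] := IH z0.
- by move=> i j iz jz; apply: tot; apply: sub.
- by move=> j i k jz iz kz; apply: tr; apply: sub.
have [xk|xk] := boolP ((x == k) || r x k).
  exists k; first exact: sub.
  move=> j; rewrite inE => /predU1P[->|/last_k//].
  by case/orP: xk => [->//|].
move: xk; rewrite negb_or => /andP[xk nxk].
have kx : r k x by move: (tot _ _ xin (sub _ kz) xk); rewrite (negbTE nxk).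
exists x => // j; rewrite inE => /predU1P[->|jz jx]; first by rewrite eqxx.
have [->//|jk] := eqVneq j k.
exact: (tr _ _ _ (sub _ kz) (sub _ jz) xin (last_k _ jz jk) kx).
Qed.

(** The three-term relation makes the order of the remaining elements
    transitive once one of them is a source: they then lie in an open
    half-plane, where turning counterclockwise is a linear order whose last
    element is the sink. *)
Lemma source_sink (R : realDomainType) (T : eqType) (z : seq T)
    (D : T -> T -> R) : uniq z -> (1 < size z)%N ->
  (forall i j, D j i = - D i j) ->
  (forall i j k l, D i j * D k l - D i k * D j l + D i l * D j k = 0) ->
  {in z &, forall i j, i != j -> D i j != 0} ->
  has (source z D) z -> has (sink z D) z.
Proof.
move=> uz sz DN DP D0 /hasP[i iz /allP/= src].
pose y := [seq j <- z | j != i].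
have yP j : j \in y -> j \in z /\ 0 < D i j.
  by rewrite mem_filter => /andP[ji jz]; have := src _ jz; rewrite (negbTE ji).
have y0 : y != [::].
  apply/eqP => y0; move: sz.
  rewrite -(count_predC (pred1 i) z) -(size_filter (predC _)) -/y.
  by rewrite y0 addn0 count_uniq_mem // ltnNge leq_b1.
have [||k ky last_k] := exists_last y0 (r := fun j k => 0 < D j k).
- move=> j k /yP[jz _] /yP[kz _] jk.
  by rewrite (DN k j) oppr_gt0 -neq_lt D0 // eq_sym.
- move=> k j l /yP[_ ik] /yP[_ ij] /yP[_ il] kj jl /=.
  have E := DP i j k l; rewrite -(pmulr_rgt0 _ ik).
  have -> : D i k * D j l = D i j * D k l + D i l * D j k.
    by rewrite -[LHS]addr0 -E; ring.
  by rewrite addr_gt0 ?mulr_gt0.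
apply/hasP; exists k; first by case/yP: ky.
apply/allP => j jz /=; case: eqVneq => //= jk.
have [->|ji] := eqVneq j i; first by case/yP: ky.
by apply: last_k; rewrite // mem_filter ji.
Qed.

(** For D i j = det (g i, g j) with pairwise independent vectors g i of the
    plane, the sources and sinks are the vectors spanning the rays that bound
    the cone dual to the g i: there are none or exactly two. *)
Lemma even_extreme (R : realDomainType) (T : eqType) (z : seq T)
    (D : T -> T -> R) : uniq z -> (1 < size z)%N ->
  (forall i j, D j i = - D i j) ->
  (forall i j k l, D i j * D k l - D i k * D j l + D i l * D j k = 0) ->
  {in z &, forall i j, i != j -> D i j != 0} ->
  \big[addb/false]_(i <- z) (source z D i (+) sink z D i) = false.
Proof.
move=> uz sz DN DP D0.
have sinkE : sink z D =1 source z (fun i j => - D i j).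
  by move=> i; apply: eq_all => j /=; rewrite -DN.
have DN' i j : - D j i = - - D i j by rewrite (DN i j).
rewrite big_split /= (addb_unique uz (source_unique DN)).
rewrite (eq_bigr _ (fun i _ => sinkE i)) (addb_unique uz (source_unique DN')).
rewrite -(eq_has sinkE).
suff -> : has (source z D) z = has (sink z D) z by rewrite addbb.
apply/idP/idP; first exact: source_sink.
rewrite (eq_has sinkE) => so; have := source_sink uz sz DN' _ _ so.
have -> : has (sink z (fun i j => - D i j)) z = has (source z D) z.
  by apply: eq_has => i; apply: eq_all => j /=; rewrite -DN.
apply=> [i j k l|i j iz jz ij]; last by rewrite oppr_eq0 D0.
by rewrite !mulrNN; exact: DP.
Qed.

(** * Crossings of cells *)

(** Points are labelled by natural numbers, and simplices are lists of labels,
    so that lists of cells can be evaluated. *)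
Definition cell := (seq nat * seq nat)%type.

Definition faces (s : seq nat) := [seq [seq u <- s | u != v] | v <- s].

Definition boundary (c : cell) : seq cell :=
  [seq (s, c.2) | s <- faces c.1] ++ [seq (c.1, t) | t <- faces c.2].

Definition dependency (R : realFieldType) (v : nat -> 'rV[R]_5) (z : seq nat)
  (w : nat -> R) := \sum_(i <- z) w i *: v i = 0.

Definition general_position (R : realFieldType) (v : nat -> 'rV[R]_5)
    (n : nat) :=
  forall z w, uniq z -> size z = 5 -> all (gtn n) z ->
    dependency v z w -> {in z, forall i, w i = 0}.

(** For homogenized points, the positive and the negative part of a dependency
    are, up to one common factor, the barycentric coordinates of a common point
    of the open simplices on s and t. *)
Definition crosses (R : realFieldType) (v : nat -> 'rV[R]_5)
    (s t : seq nat) : bool :=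
  `[< exists2 w, dependency v (s ++ t) w &
      {in s, forall i, 0 < w i} /\ {in t, forall i, w i < 0} >].

Lemma dependencyP (R : realFieldType) (v : nat -> 'rV[R]_5) z w :
  dependency v z w <-> forall k, \sum_(i <- z) w i * v i 0 k = 0.
Proof.
have E k : (\sum_(i <- z) w i *: v i) 0 k = \sum_(i <- z) w i * v i 0 k.
  by rewrite summxE; apply: eq_bigr => i _; rewrite mxE.
split=> [d k|d]; first by rewrite -E d mxE.
by apply/rowP => k; rewrite E d mxE.
Qed.

Section Dependencies.
Variables (R : realFieldType) (v : nat -> 'rV[R]_5).

Lemma dependency_lin z w1 w2 (a b : R) :
  dependency v z w1 -> dependency v z w2 ->
  dependency v z (fun i => a * w1 i + b * w2 i).
Proof.
move=> d1 d2; rewrite /dependency.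
under eq_bigr do rewrite scalerDl -!scalerA.
by rewrite big_split /= -!scaler_sumr d1 d2 !scaler0 addr0.
Qed.

Lemma dependencyZ z w (a : R) : dependency v z w ->
  dependency v z (fun i => a * w i).
Proof.
move=> d; rewrite /dependency.
by under eq_bigr do rewrite -scalerA; rewrite -scaler_sumr d scaler0.
Qed.

Lemma dependency_filter z w (P : pred nat) :
  {in z, forall i, ~~ P i -> w i = 0} ->
  dependency v [seq i <- z | P i] w <-> dependency v z w.
Proof.
move=> w0; rewrite /dependency big_filter big_mkcond /=.
suff -> : \sum_(i <- z) (if P i then w i *: v i else 0) =
          \sum_(i <- z) w i *: v i by [].
apply: eq_big_seq => i iz; case: ifPn => // /(w0 _ iz) ->.
by rewrite scale0r.
Qed.

Lemma dependency_perm s t w : perm_eq s t ->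
  dependency v s w <-> dependency v t w.
Proof. by move=> st; rewrite /dependency (perm_big _ st). Qed.

Lemma eq_dependency z w1 w2 : {in z, w1 =1 w2} ->
  dependency v z w1 -> dependency v z w2.
Proof.
move=> e d; rewrite /dependency -[RHS]d.
by apply: eq_big_seq => i /e ->.
Qed.

Lemma exists_dependency (z : seq nat) : uniq z -> (5 < size z)%N ->
  exists2 w, dependency v z w & exists2 i, i \in z & w i != 0.
Proof.
move=> uz sz; pose N := \matrix_(k < size z) v (nth 0%N z k).
have : kermx N != 0.
  rewrite kermx_eq0 -row_leq_rank -ltnNge (leq_ltn_trans (rank_leq_col N)) //.
case/rowV0Pn => u /sub_kermxP uN u0.
pose w i := oapp (u 0) 0 (insub (index i z)).
have wE (k : 'I_(size z)) : w (nth 0%N z k) = u 0 k.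
  by rewrite /w index_uniq // insubT //= => kz; congr (u 0 _); exact: val_inj.
exists w.
  rewrite /dependency (big_nth 0%N) big_mkord -[RHS]uN mulmx_sum_row.
  by apply: eq_bigr => k _; rewrite wE rowK.
have [k uk] : exists k, u 0 k != 0.
  apply/existsP; apply: contraNT u0; rewrite negb_exists => /forallP u0.
  by apply/eqP/rowP => k; rewrite mxE; apply/eqP; rewrite -[_ == _]negbK u0.
by exists (nth 0%N z k); rewrite ?mem_nth // wE.
Qed.

Hypotheses (n : nat) (gp : general_position v n).

Lemma size_rem_filter (z : seq nat) i : uniq z -> i \in z ->
  size [seq j <- z | j != i] = (size z).-1.
Proof. by move=> uz iz; rewrite -rem_filter // size_rem. Qed.

Lemma dependency6_eq0 z w i : uniq z -> size z = 6 -> all (gtn n) z ->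
  dependency v z w -> i \in z -> w i = 0 -> {in z, forall j, w j = 0}.
Proof.
move=> uz sz zn d iz wi j jz; have [->//|ji] := eqVneq j i.
have dz : dependency v [seq j <- z | j != i] w.
  by apply/dependency_filter => // k _; rewrite negbK => /eqP->.
apply: (gp _ _ _ dz); rewrite ?filter_uniq ?mem_filter ?ji //.
  by rewrite size_rem_filter // sz.
by apply/allP => k; rewrite mem_filter => /andP[_ /(allP zn)].
Qed.

Lemma dependency7_eq0 z w i j : uniq z -> size z = 7 -> all (gtn n) z ->
  dependency v z w -> i \in z -> j \in z -> i != j -> w i = 0 -> w j = 0 ->
  {in z, forall k, w k = 0}.
Proof.
move=> uz sz zn d iz jz ij wi wj k kz; have [->//|ki] := eqVneq k i.
have dz : dependency v [seq j <- z | j != i] w.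
  by apply/dependency_filter => // l _; rewrite negbK => /eqP->.
apply: (dependency6_eq0 _ _ _ dz (i := j)) => //;
  rewrite ?filter_uniq ?mem_filter ?ki ?(eq_sym j) ?ij //.
  by rewrite size_rem_filter // sz.
by apply/allP => l; rewrite mem_filter => /andP[_ /(allP zn)].
Qed.

Lemma crosses_sym s t : crosses v s t = crosses v t s.
Proof.
have sub s' t' : crosses v s' t' -> crosses v t' s'.
  move=> /asboolP[w d [ws wt]]; apply/asboolP.
  exists (fun i => -1 * w i).
    apply: dependencyZ; apply/(dependency_perm w (s := s' ++ t')) => //.
    by rewrite perm_catC.
  by split=> i /=; [move/wt|move/ws]; rewrite mulN1r ?oppr_gt0 ?oppr_lt0.
by apply/idP/idP; exact: sub.
Qed.

Lemma perm_crosses s t s' t' : perm_eq s s' -> perm_eq t t' ->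
  crosses v s t = crosses v s' t'.
Proof.
have sub a b a' b' : perm_eq a a' -> perm_eq b b' ->
    crosses v a b -> crosses v a' b'.
  move=> pa pb /asboolP[w d [ws wt]]; apply/asboolP; exists w.
    by apply/(dependency_perm w (s := a ++ b)) => //; exact: perm_cat.
  by split=> i; rewrite -?(perm_mem pa) -?(perm_mem pb); [exact: ws|exact: wt].
by move=> ps pt; apply/idP/idP; apply: sub => //; rewrite perm_sym.
Qed.

(** * Parity of Radon splittings *)

Fixpoint splits (z : seq nat) : seq cell :=
  if z is y :: z' then
    [seq (y :: c.1, c.2) | c <- splits z'] ++
    [seq (c.1, y :: c.2) | c <- splits z']
  else [:: ([::], [::])].

Lemma splits_sign (w : nat -> R) z : {in z, forall i, w i != 0} ->
  \big[addb/false]_(c <- splits z)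
     (all (fun i => 0 < w i) c.1 && all (fun i => w i < 0) c.2) = true.
Proof.
elim: z => [|y z IH] w0 /=; first by rewrite big_seq1.
rewrite big_cat !big_map /=; have := w0 y (mem_head _ _).
under eq_bigr do rewrite -andbA.
under [X in _ (+) X]eq_bigr do rewrite andbCA.
rewrite neq_lt => /orP[yn|yp].
  rewrite yn (lt_gtF yn) /= big1 // IH // => i iz; apply: w0.
  by rewrite inE iz orbT.
rewrite yp (lt_gtF yp) /= [X in _ (+) X]big1 // IH // => i iz; apply: w0.
by rewrite inE iz orbT.
Qed.

Lemma mem_splits z c : c \in splits z -> perm_eq (c.1 ++ c.2) z.
Proof.
elim: z c => [|y z IH] c /=; first by rewrite inE => /eqP->.
rewrite mem_cat => /orP[] /mapP[d /IH pd ->] /=; first by rewrite perm_cons.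
by rewrite -cat1s perm_catCA perm_cons.
Qed.

(** Six vectors in general position have, up to a factor, a single dependency,
    and it vanishes nowhere; its sign pattern is the only crossed splitting.
    Keeping x on the left counts each unordered splitting once. *)
Lemma radon_odd x z : uniq (x :: z) -> size z = 5 -> all (gtn n) (x :: z) ->
  \big[addb/false]_(c <- splits z) crosses v (x :: c.1) c.2 = true.
Proof.
move=> uz sz zn.
have [||w0 d0 [i0 i0z w0i]] := @exists_dependency (x :: z) => //.
  by rewrite /= sz.
have sz6 : size (x :: z) = 6 by rewrite /= sz.
have w0x : w0 x != 0.
  apply: contraNneq w0i => w0x.
  by rewrite (dependency6_eq0 uz sz6 zn d0 _ w0x i0z) // inE eqxx.
pose w i := (w0 x)^-1 * w0 i.
have d : dependency v (x :: z) w by exact: dependencyZ.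
have wx : w x = 1 by rewrite /w mulVf.
have wn0 i : i \in x :: z -> w i != 0.
  move=> iz; apply/eqP => wi; have /eqP := oner_neq0 R; apply.
  by rewrite -wx (dependency6_eq0 uz sz6 zn d iz wi) // inE eqxx.
have wz : {in z, forall i, w i != 0}.
  by move=> i iz; apply: wn0; rewrite inE iz orbT.
transitivity (\big[addb/false]_(c <- splits z)
    (all (fun i => 0 < w i) c.1 && all (fun i => w i < 0) c.2)); last first.
  exact: splits_sign.
apply: eq_big_seq => c /mem_splits pc.
have pxc : perm_eq ((x :: c.1) ++ c.2) (x :: z) by rewrite /= perm_cons.
apply/asboolP/andP => [[w' d' [ps nt]]|[/allP ps /allP nt]].
  move: d' => /(dependency_perm _ pxc) d'.
  have w'x : 0 < w' x by apply: ps; rewrite inE eqxx.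
  have E : {in x :: z, forall i, w' i = w' x * w i}.
    move=> i iz; apply/eqP; rewrite -subr_eq0; apply/eqP.
    have := dependency_lin 1 (- w' x) d' d => d''.
    rewrite -[w' i]mul1r -mulNr.
    apply: (dependency6_eq0 uz sz6 zn d'' (mem_head _ _)) => //=.
    by rewrite wx; ring.
  have cz i : i \in c.1 ++ c.2 -> i \in x :: z.
    by rewrite (perm_mem pc) inE orbC => ->.
  split; apply/allP => i ic.
    rewrite -(pmulr_rgt0 _ w'x) -E ?cz ?mem_cat ?ic //.
    by apply: ps; rewrite inE ic orbT.
  rewrite -(pmulr_rlt0 _ w'x) -E ?cz ?mem_cat ?ic ?orbT //.
  exact: nt.
exists w; first exact/(dependency_perm _ pxc).
split=> // i; rewrite inE => /predU1P[->|/ps//].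
by rewrite wx ltr01.
Qed.
End Dependencies.

(** * Parity of the crossed faces of a cell with seven labels *)

Section Boundary.
Variables (R : realFieldType) (v : nat -> 'rV[R]_5) (n : nat).
Hypothesis gp : general_position v n.

Lemma dependency_extend z w i : dependency v [seq j <- z | j != i] w ->
  dependency v z (fun j => if j == i then 0 else w j).
Proof.
move=> d; apply/(@dependency_filter _ _ _ _ (fun j => j != i)).
  by move=> j _; rewrite negbK => ->.
apply: eq_dependency d => j; rewrite mem_filter => /andP[ji _].
by rewrite (negbTE ji).
Qed.

(** Two such circuits, for two different labels x, are a basis of the plane of
    dependencies of seven vectors. *)
Lemma exists_circuit z x : uniq z -> size z = 7 -> all (gtn n) z -> x \in z ->
  exists a, [/\ dependency v z a, a x = 0 &
    {in z, forall j, j != x -> a j != 0}].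
Proof.
move=> uz sz zn xz.
have [||w d [i iz wi]] := @exists_dependency _ v [seq j <- z | j != x].
- exact: filter_uniq.
- by rewrite size_rem_filter // sz.
have {}d := dependency_extend d; exists (fun j => if j == x then 0 else w j).
split=> //; first by rewrite eqxx.
move=> j jz jx; apply: contraNneq wi => wj.
move: iz; rewrite mem_filter => /andP[ix iz].
have := dependency7_eq0 gp uz sz zn d jz xz jx wj.
by rewrite eqxx => /(_ erefl i iz); rewrite (negbTE ix) => ->.
Qed.

(** A crossed face omitting the label i is a dependency that vanishes at i and
    has the signs prescribed by the cell elsewhere, hence an extreme ray of the
    cone of dependencies with these signs. *)
Lemma boundary_even s t : uniq (s ++ t) -> size (s ++ t) = 7 ->
  all (gtn n) (s ++ t) ->
  \big[addb/false]_(c <- boundary (s, t)) crosses v c.1 c.2 = false.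
Proof.
move=> uz sz zn; set z := s ++ t in uz sz zn.
pose del i (u : seq nat) := [seq j <- u | j != i].
have st i : i \in s -> i \notin t.
  move=> si; apply/negP => ti; move: uz.
  by rewrite /z cat_uniq => /and3P[_ /hasP[]]; exists i.
have delN i u : i \notin u -> del i u = u.
  by move=> iu; apply/all_filterP/allP => j; apply: contraTneq => ->.
transitivity (\big[addb/false]_(i <- z) crosses v (del i s) (del i t)).
  rewrite /boundary /faces big_cat !big_map big_cat /=; congr addb.
    by apply: eq_big_seq => i si /=; rewrite (delN i t) // st.
  apply: eq_big_seq => i ti /=; rewrite (delN i s) //.
  by apply: contraL ti; exact: st.
have [x [y [xz yz xy]]] : exists x y, [/\ x \in z, y \in z & x != y].
  case: z uz sz {zn} => [//|x [//|y z]] /= /andP[xz _] _; exists x, y.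
  rewrite !inE !eqxx orbT; split=> //.
  by apply: contraNneq xz => ->; rewrite mem_head.
have [a [da ax an0]] := exists_circuit uz sz zn xz.
have [b [db yb bn0]] := exists_circuit uz sz zn yz.
(* [d i] is a dependency that vanishes at [i], and [d i j] is a determinant of
   coordinates in the plane of dependencies; [D] corrects it by the signs that
   the cell prescribes. *)
pose e i : R := if i \in s then 1 else -1.
pose d i j := a i * b j - a j * b i.
pose D i j := e i * e j * d i j.
have DN i j : D j i = - D i j by rewrite /D /d; ring.
have DP i j k l : D i j * D k l - D i k * D j l + D i l * D j k = 0.
  by rewrite /D /d; ring.
have dd i : dependency v z (d i).
  apply: eq_dependency (dependency_lin (a i) (- b i) db da) => j _.
  by rewrite /d; ring.
have d0 : {in z &, forall i j, i != j -> d i j != 0}.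
  move=> i j iz jz ij; apply/eqP => dij.
  have dii : d i i = 0 by rewrite /d; ring.
  have dz := dependency7_eq0 gp uz sz zn (dd i) iz jz ij dii dij.
  have ix : i = x.
    apply/eqP; apply: contraT => /(an0 _ iz) ai.
    have := dz _ xz; rewrite /d ax mul0r subr0 => /eqP.
    by rewrite mulf_eq0 (negbTE ai) (negbTE (bn0 _ xz xy)).
  have iy : i = y.
    apply/eqP; apply: contraT => /(bn0 _ iz) bi.
    have := dz _ yz; rewrite /d yb mulr0 sub0r => /eqP.
    rewrite oppr_eq0 mulf_eq0 (negbTE bi) orbF.
    by rewrite (negbTE (an0 _ yz _)) // eq_sym.
  by move: xy; rewrite -ix iy eqxx.
have e0 i : e i != 0 by rewrite /e; case: ifP; rewrite ?oppr_eq0 oner_eq0.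
have D0 : {in z &, forall i j, i != j -> D i j != 0}.
  by move=> i j iz jz ij; rewrite !mulf_neq0 // d0.
rewrite -[RHS](even_extreme uz _ DN DP D0) ?sz //.
apply: eq_big_seq => i iz.
have [l lz li] : exists2 l, l \in z & l != i.
  case: (eqVneq x i) xy => [<- xy|xi _]; last by exists x.
  by exists y; rewrite // eq_sym.
have il : i != l by rewrite eq_sym.
have signP w : {in z, forall j, j != i -> 0 < e j * w j} <->
    {in del i s, forall j, 0 < w j} /\ {in del i t, forall j, w j < 0}.
  split=> [ew|[ws wt] j].
    split=> j; rewrite mem_filter => /andP[ji ju].
      by have := ew j; rewrite /z mem_cat ju /e ju mul1r => ->.
    have := ew j; rewrite /z mem_cat ju orbT /e ifN; last first.
      by apply: contraL ju; exact: st.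
    by rewrite mulN1r oppr_gt0 => ->.
  rewrite /z mem_cat /e; case: ifPn => /= [js _ ji|_ jt ji].
    by rewrite mul1r ws // mem_filter ji.
  by rewrite mulN1r oppr_gt0 wt // mem_filter ji.
have delz : del i s ++ del i t = del i z by rewrite /del -filter_cat.
have -> : source z D i (+) sink z D i = source z D i || sink z D i.
  case: (boolP (source z D i)) => //= /allP/(_ _ lz) /=.
  rewrite (negbTE li) /= => Dil; apply/negP => /allP/(_ _ lz) /=.
  by rewrite (negbTE li) /= DN oppr_gt0 ltNge ltW.
apply/asboolP/orP => [[w' dw' /signP pw']|].
  rewrite delz in dw'; have := dependency_extend dw'.
  set w := (fun j => _) => dw.
  have wi : w i = 0 by rewrite /w eqxx.
  have pw j : j \in z -> j != i -> 0 < e j * w j.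
    by move=> jz ji; rewrite /w (negbTE ji) pw'.
  (* Dependencies that vanish at [i] are proportional. *)
  have E j : j \in z -> w l * d i j = d i l * w j.
    move=> jz; apply/eqP; rewrite -subr_eq0; apply/eqP; rewrite -mulNr.
    have := dependency_lin (w l) (- d i l) (dd i) dw.
    move=> /(dependency7_eq0 gp uz sz zn)/(_ iz lz il).
    by apply=> //; rewrite ?wi /d; ring.
  have F j : j \in z -> (e l * w l) * D i j = D i l * (e j * w j).
    move=> jz; rewrite /D; transitivity (e l * e i * e j * (w l * d i j)).
      by ring.
    by rewrite E //; ring.
  have := D0 _ _ iz lz il; rewrite neq_lt => /orP[Dn|Dp].
    right; apply/allP => j jz /=; have [//|ji /=] := eqVneq j i.
    rewrite DN oppr_gt0 -(pmulr_rlt0 _ (pw l lz li)) F //.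
    by rewrite nmulr_rlt0 // pw.
  left; apply/allP => j jz /=; have [//|ji /=] := eqVneq j i.
  rewrite -(pmulr_rgt0 _ (pw l lz li)) F //.
  by rewrite pmulr_rgt0 // pw.
have crossesP c : {in z, forall j, j != i -> 0 < c * D i j} ->
    exists2 w, dependency v (del i s ++ del i t) w &
      {in del i s, forall i, 0 < w i} /\ {in del i t, forall i, w i < 0}.
  move=> pD; exists (fun j => c * e i * d i j).
    rewrite delz; apply/dependency_filter; last exact: dependencyZ.
    by move=> j _; rewrite negbK => /eqP->; rewrite /d; ring.
  apply/signP => j jz ji.
  have -> : e j * (c * e i * d i j) = c * D i j by rewrite /D; ring.
  exact: pD.
case=> /allP ext; [apply: (crossesP 1)|apply: (crossesP (-1))] => j jz ji.
  by rewrite mul1r; have := ext j jz; rewrite (negbTE ji).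
by rewrite mulN1r -DN; have := ext j jz; rewrite (negbTE ji).
Qed.
End Boundary.

(** * Chains modulo 2 *)

Local Open Scope nat_scope.

Fixpoint lex (s t : seq nat) := match s, t with
  | [::], _ => true
  | _, [::] => false
  | x :: s', y :: t' => (x < y) || ((x == y) && lex s' t')
  end.

(** Crossing is invariant under permuting the labels of either side and under
    swapping the sides, so cells are compared up to these operations. *)
Definition canonical (c : cell) : cell :=
  let s := sort leq c.1 in let t := sort leq c.2 in
  if lex s t then (s, t) else (t, s).

Definition cell_le (c d : cell) :=
  lex (size c.1 :: c.1 ++ c.2) (size d.1 :: d.1 ++ d.2).

Fixpoint cancel_pairs (acc c : seq cell) :=
  if c is x :: c' then
    if acc is y :: acc' then
      if x == y then cancel_pairs acc' c' else cancel_pairs (x :: acc) c'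
    else cancel_pairs [:: x] c'
  else acc.

Definition null_mod2 c :=
  nilp (cancel_pairs [::] (sort cell_le (map canonical c))).

Definition crossings (R : realFieldType) (v : nat -> 'rV[R]_5) (c : seq cell) :=
  \big[addb/false]_(d <- c) crosses v d.1 d.2.

Lemma crossings_cat (R : realFieldType) (v : nat -> 'rV[R]_5) c d :
  crossings v (c ++ d) = crossings v c (+) crossings v d.
Proof. exact: big_cat. Qed.

Lemma crossings_cancel (R : realFieldType) (v : nat -> 'rV[R]_5) acc c :
  crossings v (cancel_pairs acc c) = crossings v acc (+) crossings v c.
Proof.
rewrite /crossings; elim: c acc => [|x c IH] acc /=.
  by rewrite big_nil addbF.
case: acc => [|y acc]; first by rewrite IH !big_cons !big_nil addbF.
case: eqP => [->|_]; rewrite IH !big_cons.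
  by rewrite addbACA addbb.
by rewrite -addbA addbCA.
Qed.

(** Sorting permutes a list of cells and cancelling removes equal neighbours two
    by two; both preserve the parity of the crossings. *)
Lemma crossings_null_mod2 (R : realFieldType) (v : nat -> 'rV[R]_5) c :
  null_mod2 c -> crossings v c = false.
Proof.
move=> /nilP c0.
have := crossings_cancel v [::] (sort cell_le (map canonical c)).
rewrite c0 /crossings !big_nil addFb.
rewrite (perm_big (map canonical c)) /=; last first.
  by rewrite perm_sort.
rewrite big_map => {c0} c0; rewrite [RHS]c0; apply: eq_bigr => d _.
rewrite /canonical.
have E : crosses v d.1 d.2 = crosses v (sort leq d.1) (sort leq d.2).
  by apply: perm_crosses; rewrite perm_sym perm_sort.
by case: ifP => _ //=; rewrite E ?(crosses_sym v (sort leq d.2)).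
Qed.

(** * The homology from the product to a Radon splitting *)

Definition label (j p : nat) := 5 * j + p.

(** The (3,3)-product on the rows J and the columns P; it triangulates the
    torus that is the product of two triangular cycles. *)
Definition torus (J P : seq nat) : seq (seq nat) :=
  flatten [seq [:: [:: label e.1.1 e.2.1; label e.1.2 e.2.2; label e.1.1 e.2.2];
                   [:: label e.1.1 e.2.1; label e.1.2 e.2.2; label e.1.2 e.2.1]]
          | e <- [seq (x, y) | x <- [seq (j, k) | j <- J, k <- J],
                               y <- [seq (p, q) | p <- P, q <- P]]
          & (e.1.1 < e.1.2) && (e.2.1 < e.2.2)].

Definition apex := label 0 4.

Definition star (z : seq (seq nat)) := [seq s <- z | apex \in s].

Definition costar (z : seq (seq nat)) := [seq s <- z | apex \notin s].

(** A cycle z is modulo 2 the boundary of [cone w z] for any vertex w of z: the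
    faces opposite to w are the simplices of z that avoid w, and the faces
    through w that do not cancel are the other simplices of z. *)
Definition cone w (z : seq (seq nat)) := [seq w :: s | s <- z & w \notin s].

Definition cross_prod (x y : seq (seq nat)) : seq cell :=
  [seq (s, t) | s <- x, t <- y].

(** The link of [apex] is K_{4,4}.  For i, l in {1, 2, 3} its first 4-cycle has
    the columns 0, i of row 0 and the rows of column 4 other than l and 4; its
    second one has the remaining vertices.  The tori and discs below are those
    spanned by these two cycles. *)
Definition torus1 i l := torus (0 :: rem l [:: 1; 2; 3]) [:: 0; i; 4].

Definition torus2 i l := torus [:: 0; l; 4] (rcons (rem i [:: 1; 2; 3]) 4).

Definition disc1 i l :=
  [seq [:: label 0 0; label 0 i; label k 4] | k <- rem l [:: 1; 2; 3]].

Definition disc2 i l :=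
  [seq [:: label l 4; label 4 4; label 0 c] | c <- rem i [:: 1; 2; 3]].

Definition sum_pairs (F : nat -> nat -> seq cell) : seq cell :=
  flatten [seq F i l | i <- [:: 1; 2; 3], l <- [:: 1; 2; 3]].

(** The part of the product of the two tori where the triangles are disjoint:
    only the pairs of triangles that both contain [apex] are missing. *)
Definition product_cells := sum_pairs (fun i l =>
  cross_prod (costar (torus1 i l)) (torus2 i l) ++
  cross_prod (star (torus1 i l)) (costar (torus2 i l))).

Definition torus_filling := sum_pairs (fun i l =>
  cross_prod (cone (label 0 0) (costar (torus1 i l) ++ disc1 i l))
             (torus2 i l) ++
  cross_prod (star (torus1 i l) ++ disc1 i l)
             (cone (label 4 4) (costar (torus2 i l) ++ disc2 i l))).

Definition join (x y : seq cell) : seq cell :=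
  [seq (c.1 ++ d.1, c.2 ++ d.2) | c <- x, d <- y].

(** Chains of dimension one or two in the space of pairs of disjoint faces on
    three points.  [hexagon] is its part with a single point on either side,
    [square] the part supported by x and y, and their difference modulo 2 is
    the boundary of [strip].  A cell and its swapped copy stand for the same
    pair of simplices; taking [half_square] for one factor of a join lists only
    one of the two copies. *)
Definition hexagon x y z : seq cell :=
  [:: ([:: x], [:: y]); ([:: y], [:: x]); ([:: x], [:: z]);
      ([:: z], [:: x]); ([:: y], [:: z]); ([:: z], [:: y])].

Definition half_square x y : seq cell :=
  [:: ([:: x; y], [::]); ([:: x], [:: y])].

Definition square x y : seq cell :=
  half_square x y ++ [:: ([:: y], [:: x]); ([::], [:: x; y])].

Definition strip x y z : seq cell :=
  [:: ([:: x; y], [:: z]); ([:: z], [:: x; y])].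

(** Replaces the hexagons by squares, one factor after the other.  The first
    factor is halved, and the boundary of its half square consists of two
    swapped cells, whose joins with the symmetric chains that follow cancel. *)
Definition join_filling : seq cell :=
  let: (x, y, z) := (apex, label 0 0, label 4 4) in
  let: (a1, a2, a3) := (label 0 1, label 0 2, label 0 3) in
  let: (b1, b2, b3) := (label 1 4, label 2 4, label 3 4) in
  join (join [:: ([:: x; y], [:: z])] (hexagon a1 a2 a3)) (hexagon b1 b2 b3) ++
  join (join (half_square x y) (strip a1 a2 a3)) (hexagon b1 b2 b3) ++
  join (join (half_square x y) (square a1 a2)) (strip b1 b2 b3).

Definition radon_points :=
  [:: label 0 0; label 0 1; label 0 2; label 1 4; label 2 4].

Definition radon_cells : seq cell :=
  [seq (apex :: c.1, c.2) | c <- splits radon_points].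

Definition filling := torus_filling ++ join_filling.

(** The only computation on which the parity of the crossings in the product
    rests: about fifteen thousand cells cancel in pairs. *)
Lemma product_homologous_radon :
  null_mod2 (product_cells ++ radon_cells ++ flatten (map boundary filling)).
Proof. by vm_compute. Qed.

Lemma filling_size7 : all (fun c => [&& uniq (c.1 ++ c.2),
  size (c.1 ++ c.2) == 7 & all (gtn 25) (c.1 ++ c.2)]) filling.
Proof. by vm_compute. Qed.

Local Close Scope nat_scope.

Lemma product_crossing (R : realFieldType) (v : nat -> 'rV[R]_5) :
  general_position v 25 ->
  has (fun c => crosses v c.1 c.2) product_cells.
Proof.
move=> gp; have := crossings_null_mod2 v product_homologous_radon.
rewrite (crossings_cat v product_cells) (crossings_cat v radon_cells).
have -> : crossings v radon_cells = true.
  by rewrite /crossings /radon_cells big_map; exact: (radon_odd gp).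
have -> : crossings v (flatten (map boundary filling)) = false.
  rewrite /crossings big_flatten big_map big_seq big1 // => c.
  move=> /(allP filling_size7)/and3P[uc /eqP sc nc].
  by case: c uc sc nc => s t; exact: boundary_even.
rewrite addbF addbT => /negbFE; apply: contraTT => /hasPn no.
by rewrite /crossings big_seq big1 // => c /no/negbTE.
Qed.

(** * Perturbation into general position *)

Definition segment_conf (R : realFieldType) (p q : nat -> 'rV[R]_5) (e : R)
    (i : nat) : 'rV[R]_5 :=
  (1 - e) *: p i + e *: q i.

Lemma segment_confE (R : realFieldType) (p q : nat -> 'rV[R]_5) e i k :
  segment_conf p q e i 0 k = (1 - e) * p i 0 k + e * q i 0 k.
Proof. by rewrite !mxE. Qed.

Definition moment_point (R : realFieldType) (i : nat) : 'rV[R]_5 :=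
  \row_(k < 5) i%:R ^+ k.

Lemma general_position_det (R : realFieldType) (v : nat -> 'rV[R]_5) n :
  (forall z : 5.-tuple 'I_n, uniq z ->
     \det (\matrix_(k < 5) v (tnth z k)) != 0) -> general_position v n.
Proof.
move=> det0 z w uz sz zn d.
pose y := pmap (insub : nat -> option 'I_n) z.
have yz : map val y = z.
  rewrite pmap_filter; last exact: insubK.
  by apply/all_filterP/(sub_all _ zn) => i; rewrite /= isSome_insub.
have sy : size y == 5 by rewrite -(size_map val) yz sz.
have uy : uniq y by rewrite -(map_inj_uniq val_inj) yz.
have nz := det0 (Tuple sy) uy; set M := \matrix_(k < 5) _ in nz.
pose u : 'rV[R]_5 := \row_k w (tnth (Tuple sy) k).
have uM : u *m M = 0.
  rewrite -[RHS]d mulmx_sum_row -{1}yz big_map.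
  rewrite -[y]/(val (Tuple sy)) big_tuple.
  by apply: eq_bigr => k _; rewrite rowK mxE.
have Mu : M \in unitmx by rewrite unitmxE unitfE.
have u0 : u = 0 by rewrite -[u](mulmxK Mu) uM mul0mx.
move=> i; rewrite -yz => /mapP[j jy ->].
have /tnthP[k ->] : j \in Tuple sy by [].
by have := congr1 (fun r : 'rV_5 => r 0 k) u0; rewrite !mxE.
Qed.

Lemma moment_det (R : realFieldType) n (z : 5.-tuple 'I_n) : uniq z ->
  \det (\matrix_(k < 5) moment_point R (tnth z k)) != 0.
Proof.
move=> uz; pose a : 'rV[R]_5 := \row_k (tnth z k)%:R.
have -> : \matrix_(k < 5) moment_point R (tnth z k) = (Vandermonde 5 a)^T.
  by apply/matrixP => k l; rewrite !mxE.
rewrite det_tr det_Vandermonde; apply/prodf_neq0 => i _.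
apply/prodf_neq0 => j ij; rewrite !mxE subr_eq0 eqr_nat val_eqE.
by rewrite (inj_eq (tuple_uniqP z uz)) neq_ltn ij orbT.
Qed.

(** P is the product of the determinants of all quintuples, as polynomials in
    the time e; it does not vanish at time 1, where they are Vandermonde
    determinants. *)
Lemma generic_poly (R : realFieldType) (p : nat -> 'rV[R]_5) n :
  exists2 P : {poly R}, P != 0 & forall e, P.[e] != 0 ->
    general_position (segment_conf p (moment_point R) e) n.
Proof.
pose B (z : 5.-tuple 'I_n) : 'M[{poly R}]_5 := \matrix_(k < 5, l < 5)
  ((1 - 'X) * (p (tnth z k) 0 l)%:P + 'X * (moment_point R (tnth z k) 0 l)%:P).
have BE z e : (\det (B z)).[e] =
    \det (\matrix_(k < 5) segment_conf p (moment_point R) e (tnth z k)).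
  rewrite -horner_evalE -det_map_mx; congr (\det _).
  by apply/matrixP => k l; rewrite !mxE /= horner_evalE !hornerE.
exists (\prod_(z : 5.-tuple 'I_n | uniq z) \det (B z)).
  apply/prodf_neq0 => z uz; apply: contra_neq (moment_det R uz) => Bz.
  transitivity ((\det (B z)).[1]); last by rewrite Bz horner0.
  rewrite BE; congr (\det _); apply/matrixP => k l.
  by rewrite !mxE subrr mul0r add0r mul1r.
move=> e; rewrite horner_prod => /prodf_neq0 nz.
by apply: general_position_det => z uz; rewrite -BE nz.
Qed.

(** * Triangles with a common point *)

(** A closed version of [crosses]: the hulls of the points on s and t have a
    common point, possibly on their boundaries.  This is what survives in the
    limit of crossings. *)
Definition touching (R : realFieldType) (v : nat -> 'rV[R]_5)
    (s t : seq nat) : Prop :=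
  exists2 w, dependency v (s ++ t) w &
    [/\ {in s, forall i, 0 <= w i}, {in t, forall i, w i <= 0} &
        \sum_(i <- s) w i = 1].

Lemma mem_le_sum (R : realFieldType) (w : nat -> R) s i :
  {in s, forall j, 0 <= w j} -> i \in s -> w i <= \sum_(j <- s) w j.
Proof.
move=> w0 si; rewrite (big_rem i si) /= lerDl.
by rewrite big_seq sumr_ge0 // => j /mem_rem/w0.
Qed.

(** The first coordinate of homogenized points forces the weights on t to sum
    to -1, so that all weights are bounded. *)
Lemma crosses_normalized (R : realFieldType) (v : nat -> 'rV[R]_5) s t :
  (forall i, v i 0 0 = 1) -> uniq (s ++ t) -> s != [::] -> crosses v s t ->
  exists2 w, [/\ {in s, forall i, 0 <= w i <= 1},
                 {in t, forall i, -1 <= w i <= 0} &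
                 forall i, i \notin s ++ t -> w i = 0] &
    dependency v (s ++ t) w /\ \sum_(i <- s) w i = 1.
Proof.
move=> v1 ust s0 /asboolP[w0 d0 [ws wt]].
pose S := \sum_(i <- s) w0 i.
have S0 : 0 < S.
  case: s s0 ws @S {ust d0} => [//|x s] _ ws S; rewrite /S big_cons.
  rewrite ltr_wpDr ?ws ?mem_head // big_seq sumr_ge0 // => i si.
  by rewrite ltW // ws // inE si orbT.
pose w i := if i \in s ++ t then S^-1 * w0 i else 0.
have wE : {in s ++ t, forall i, S^-1 * w0 i = w i}.
  by move=> i iz; rewrite /w iz.
have sE i : i \in s -> w i = S^-1 * w0 i by move=> si; rewrite /w mem_cat si.
have tE i : i \in t -> w i = S^-1 * w0 i.
  by move=> ti; rewrite /w mem_cat ti orbT.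
have d : dependency v (s ++ t) w by apply: eq_dependency wE (dependencyZ _ d0).
have sum1 : \sum_(i <- s) w i = 1.
  by rewrite (eq_big_seq _ sE) -mulr_sumr mulVf // gt_eqF.
have w_ge0 : {in s, forall i, 0 <= w i}.
  by move=> i si; rewrite sE // mulr_ge0 ?invr_ge0 ?ltW // ws.
have w_le0 : {in t, forall i, 0 <= - w i}.
  move=> i ti; rewrite tE // -mulrN mulr_ge0 ?invr_ge0 ?ltW //.
  by rewrite oppr_gt0 wt.
have sumt : \sum_(i <- t) - w i = 1.
  have := congr1 (fun r : 'rV_5 => r 0 0) d; rewrite /= summxE big_cat /=.
  under eq_bigr do rewrite mxE v1 mulr1.
  under [X in _ + X]eq_bigr do rewrite mxE v1 mulr1.
  by rewrite sum1 mxE sumrN => /eqP; rewrite addr_eq0 => /eqP.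
exists w; split=> //.
- by move=> i si; rewrite w_ge0 // -sum1 mem_le_sum.
- move=> i ti; rewrite -oppr_ge0 w_le0 // andbT lerNl -sumt.
  exact: (mem_le_sum (w := fun i => - w i)).
- by move=> i /negbTE iz; rewrite /w iz.
Qed.

Lemma convex_comb (R : realType) (n : nat) (C : set 'rV[R]_n) (z : seq nat)
    (x : nat -> 'rV[R]_n) (w : nat -> R) : @convex_set R 'rV[R]_n C ->
  {in z, forall i, C (x i)} -> {in z, forall i, 0 <= w i} ->
  \sum_(i <- z) w i = 1 -> C (\sum_(i <- z) w i *: x i).
Proof.
move=> cC; elim: z w => [|i z IH] w Cx w0.
  by rewrite big_nil => /eqP; rewrite eq_sym oner_eq0.
rewrite !big_cons; set S := \sum_(j <- z) w j => S1.
have w0z : {in z, forall j, 0 <= w j}.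
  by move=> j jz; apply: w0; rewrite inE jz orbT.
have Cz : {in z, forall j, C (x j)}.
  by move=> j jz; apply: Cx; rewrite inE jz orbT.
have Ci := Cx _ (mem_head i z).
have S_ge0 : 0 <= S by rewrite /S big_seq sumr_ge0.
have wi0 : 0 <= w i by apply: w0; exact: mem_head.
have [S0|S0] := eqVneq S 0.
  rewrite big_seq big1 ?addr0.
    by move: S1; rewrite S0 addr0 => ->; rewrite scale1r.
  move=> j jz; suff -> : w j = 0 by rewrite scale0r.
  by apply/eqP; rewrite eq_le w0z // -S0 andbT mem_le_sum.
have wi1 : w i <= 1 by rewrite -S1 lerDl.
have -> : \sum_(j <- z) w j *: x j = S *: \sum_(j <- z) (S^-1 * w j) *: x j.
  by rewrite scaler_sumr; apply: eq_bigr => j _; rewrite scalerA mulVKf.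
have Cy : C (\sum_(j <- z) (S^-1 * w j) *: x j).
  apply: IH => //; last by rewrite -mulr_sumr mulVf.
  by move=> j jz; rewrite mulr_ge0 ?invr_ge0 // w0z.
have := cC _ _ (Itv01 wi0 wi1) (mem_set Ci) (mem_set Cy).
rewrite inE; congr C; congr (_ + _ *: _).
suff SE : S = 1 - w i by rewrite SE.
by rewrite -S1 addrC addKr.
Qed.

Definition homogenize (R : realFieldType) (x : 'rV[R]_4) : 'rV[R]_5 :=
  row_mx (const_mx 1 : 'rV_1) x.

Lemma homogenize0 (R : realFieldType) (x : 'rV[R]_4) : homogenize x 0 0 = 1.
Proof.
have := row_mxEl (const_mx 1 : 'rV_1) x 0 0; rewrite [RHS]mxE => <-.
by congr (_ _ _); exact: val_inj.
Qed.

Definition vertex_set (R : realType) (x : nat -> 'rV[R]_4) (s : seq nat) :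
  set 'rV[R]_4 := [set x i | i in [set` s]].

Lemma touching_hulls (R : realType) (x : nat -> 'rV[R]_4) s t :
  touching (fun i => homogenize (x i)) s t ->
  convex_hull (vertex_set x s) `&` convex_hull (vertex_set x t) !=set0.
Proof.
case=> w d [ws wt sum1].
have sum0 : \sum_(i <- s ++ t) w i = 0.
  have /dependencyP/(_ 0) d0 := d; rewrite -[RHS]d0.
  by apply: eq_bigr => i _; rewrite homogenize0 mulr1.
have bary0 : \sum_(i <- s ++ t) w i *: x i = 0.
  have := congr1 (@rsubmx _ 1 1 4) d; rewrite linear_sum linear0 /=.
  by under eq_bigr do rewrite linearZ /= row_mxKr.
have hull (z : seq nat) u : {in z, forall i, 0 <= u i} ->
    \sum_(i <- z) u i = 1 ->
    convex_hull (vertex_set x z) (\sum_(i <- z) u i *: x i).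
  move=> u0 u1 C [cC zC]; apply: convex_comb => // i iz.
  by apply: zC; exists i.
exists (\sum_(i <- s) w i *: x i); split; first exact: hull.
have -> : \sum_(i <- s) w i *: x i = \sum_(i <- t) (- w i) *: x i.
  under [RHS]eq_bigr do rewrite scaleNr.
  by move/eqP: bary0; rewrite big_cat sumrN addr_eq0 => /eqP.
apply: hull; first by move=> i it; rewrite oppr_ge0 wt.
by rewrite sumrN; move/eqP: sum0; rewrite big_cat /= addr_eq0 sum1 => /eqP.
Qed.

(** A test on labels, so that it can be evaluated on all of [product_cells]. *)
Definition product_triangle (s : seq nat) :=
  if s is [:: a; b; c] then
    [&& a %/ 5 < b %/ 5 < 5, a %% 5 < b %% 5 &
        (c == label (a %/ 5) (b %% 5)) || (c == label (b %/ 5) (a %% 5))]%N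
  else false.

Lemma product_triangleP (R : realType) (A : 'I_5 -> 'I_5 -> 'rV[R]_4) s :
  product_triangle s ->
  mn_product A (vertex_set (fun i => A (inord (i %/ 5)) (inord (i %% 5))) s).
Proof.
case: s => [|a [|b [|c []]]] //= /and3P[/andP[ab b5] ab' c_eq].
have divE j p : (p < 5)%N -> (label j p %/ 5 = j)%N.
  by move=> p5; rewrite /label mulnC divnMDl // divn_small // addn0.
have modE j p : (p < 5)%N -> (label j p %% 5 = p)%N.
  by move=> p5; rewrite /label mulnC modnMDl modn_small.
have m5 i : (i %% 5 < 5)%N by rewrite ltn_mod.
exists (inord (a %/ 5)), (inord (b %/ 5)), (inord (a %% 5)), (inord (b %% 5)).
split; rewrite ?inordK ?m5 //; first exact: ltn_trans ab b5.
set x := fun i => _.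
have -> : vertex_set x [:: a; b; c] = [set x a; x b; x c].
  apply/seteqP; split=> y /=.
    case=> i; rewrite /= !inE => /or3P[] /eqP -> <-.
    - by left; left.
    - by left; right.
    - by right.
  move=> [[]|] ->; [exists a|exists b|exists c] => //;
    by rewrite /= !inE eqxx ?orbT.
by case/orP: c_eq => /eqP ->; [left|right]; rewrite /x divE ?modE ?m5.
Qed.

(** * Stability of disjointness under perturbation *)

From mathcomp Require Import topology normedtype.
Import numFieldNormedType.Exports.

Local Notation weights R := (prod_topology (fun _ : nat => R)).

Lemma weighted_sum_continuous (R : realType) (z : seq nat) (a b : nat -> R) :
  continuous (fun x : weights R * R =>
    \sum_(i <- z) x.1 i * ((1 - x.2) * a i + x.2 * b i) : R).
Proof.
have c1 i : continuous (fun x : weights R * R => x.1 i).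
  move=> x; apply: (@cvg_comp _ _ _ fst (fun w : weights R => w i)).
    exact: cvg_fst.
  exact: (@proj_continuous nat (fun=> R) i).
have c2 : continuous (fun x : weights R * R => x.2).
  by move=> x; exact: cvg_snd.
have c3 i : continuous
    (fun x : weights R * R => (1 - x.2) * a i + x.2 * b i).
  move=> x.
  exact: (cvgD (cvgMl (cvgB (cvg_cst _) (c2 x))) (cvgMl (c2 x))).
apply: continuous_big.
  by move=> x; apply: add_continuous.
move=> i _ x; exact: (cvgM (c1 i x) (c3 i x)).
Qed.

Lemma compact_box (R : realType) (lo hi : nat -> R) :
  compact [set w : weights R | forall i, lo i <= w i <= hi i].
Proof.
have := @tychonoff nat (fun=> R) (fun i => `[lo i, hi i]%classic)
  (fun i => @segment_compact R _ _).
set A := (X in compact X -> _); set B := (X in _ -> compact X).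
suff -> : A = B by [].
by apply/seteqP; split=> w h i; have := h i; rewrite /= in_itv.
Qed.

Lemma weighted_sum_near (R : realType) (z : seq nat) (a b : nat -> R) (c : R)
   (w : weights R) (e : R) :
  \sum_(i <- z) w i * ((1 - e) * a i + e * b i) != c ->
  \forall x \near (w, e),
    \sum_(i <- z) x.1 i * ((1 - x.2) * a i + x.2 * b i) != c.
Proof.
rewrite -subr_eq0 => ne0.
have FF : Filter (nbhs (w, e)) := nbhs_filter _.
have cv := cvgB (@weighted_sum_continuous R z a b (w, e)) (cvg_cst c).
have := cvgr_neq0 _ (cv FF FF) ne0 => /(_ FF).
by apply: filterS => x; rewrite /= subr_eq0.
Qed.

(** The normalized weights range over a compact box, and at each of them one of
    the finitely many equations that express a crossing fails at time 0, hence
    near it; finitely many of these neighbourhoods cover the box. *)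
Lemma not_touching_near (R : realType) (p q : nat -> 'rV[R]_5) s t :
  (forall i, p i 0 0 = 1) -> (forall i, q i 0 0 = 1) ->
  uniq (s ++ t) -> s != [::] -> ~ touching p s t ->
  \forall e \near (0 : R), ~~ crosses (segment_conf p q e) s t.
Proof.
move=> p1 q1 ust s0 ntouch.
pose lo i : R := if i \in t then -1 else 0.
pose hi i : R := if i \in s then 1 else 0.
have st i : i \in s -> i \in t = false.
  move=> si; apply/negP => ti; move: ust.
  by rewrite cat_uniq => /and3P[_ /hasP[]]; exists i.
have /compact_near_coveringP cov := @compact_box R lo hi.
pose P (e : R) (w : weights R) :=
  ~ (\sum_(i <- s) w i = 1 /\ dependency (segment_conf p q e) (s ++ t) w).
have near_P : \forall e \near nbhs (0 : R),
   [set w : weights R | forall i, lo i <= w i <= hi i]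
     `<=` P e.
  apply: cov => w wbox /=.
  have [sum1|sumN1] := eqVneq (\sum_(i <- s) w i) 1; last first.
    have := @weighted_sum_near R s (fun=> 1) (fun=> 1) 1 w 0.
    under eq_bigr do rewrite subr0 mul0r addr0 !mulr1.
    move=> /(_ sumN1); apply: (@filterS _ (nbhs (w, 0 : R))).
    move=> -[w' e] /= + [sum1 _] => /eqP; apply.
    by rewrite -[RHS]sum1; apply: eq_bigr => i _; ring.
  have [k dk] : exists k,
      \sum_(i <- s ++ t) w i * ((1 - 0) * p i 0 k + 0 * q i 0 k) != 0.
    apply/not_existsP => all0; apply: ntouch; exists w.
      apply/dependencyP => k; have /negP := all0 k.
      rewrite negbK => /eqP sk; rewrite -[RHS]sk.
      by apply: eq_bigr => i _; rewrite subr0 mul1r mul0r addr0.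
    split=> // i iu; have := wbox i; rewrite /lo /hi.
      by rewrite st // => /andP[].
    by rewrite iu ifN => [/andP[]//|]; apply: contraL iu => /st ->.
  have := weighted_sum_near dk.
  apply: (@filterS _ (nbhs (w, 0 : R))) => -[w' e] /= + [_ /dependencyP d].
  move=> /eqP; apply; rewrite -[RHS](d k).
  by apply: eq_bigr => i _; rewrite segment_confE.
apply: filterS near_P => e Pe; apply/negP => /crosses_normalized.
case=> // [i|w [ws wt w0] [d sum1]].
  by rewrite segment_confE p1 q1; ring.
apply: (Pe w) => //= i; rewrite /lo /hi.
have [si|si] := boolP (i \in s); first by rewrite st // ws.
have [ti|ti] := boolP (i \in t); first exact: wt.
by rewrite w0 ?lexx // mem_cat negb_or si.
Qed.

Lemma near_all_seq (T : eqType) (U : Type) (F : set_system U) {FF : Filter F}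
    (s : seq T) (P : T -> U -> Prop) :
  {in s, forall c, \forall x \near F, P c x} ->
  \forall x \near F, {in s, forall c, P c x}.
Proof.
elim: s => [|c s IH] Ps; first exact: nearW.
have Pc := Ps _ (mem_head c s).
have /IH {}IH : {in s, forall d, \forall x \near F, P d x}.
  by move=> d ds; apply: Ps; rewrite inE ds orbT.
by apply: filterS2 Pc IH => x Pcx IHx d; rewrite inE => /predU1P[->|/IHx].
Qed.

(** Among the [size P] points d / (k + 2) of a ball around 0, one is not a root
    of P. *)
Lemma near0_nonroot (R : realType) (P : {poly R}) (S : set R) :
  P != 0 -> nbhs (0 : R) S -> exists2 e, S e & P.[e] != 0.
Proof.
move=> P0 /nbhs_ballP[d /= d0 dS]; pose x k := d / k.+2%:R.
have xS k : S (x k).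
  apply: dS; rewrite /ball /= sub0r normrN ger0_norm ?divr_ge0 ?ltW //.
  by rewrite ltr_pdivrMr // ltr_pMr // ltr1n.
have x_inj : injective x.
  move=> i j /(mulfI (lt0r_neq0 d0))/invr_inj/eqP.
  by rewrite eqr_nat => /eqP[].
have [/hasP[e /mapP[k _ ->] ex]|/hasPn allroot] :=
  boolP (has (fun e => P.[e] != 0) (map x (iota 0 (size P)))).
  by exists (x k).
have roots_x : all (root P) (map x (iota 0 (size P))).
  by apply/allP => e /allroot; rewrite negbK rootE.
have := max_poly_roots P0 roots_x.
by rewrite map_inj_uniq ?iota_uniq // size_map size_iota ltnn => /(_ isT).
Qed.

Lemma touching_of_generic_crossing (R : realType) (n : nat) (cells : seq cell)
    (p : nat -> 'rV[R]_5) : (forall i, p i 0 0 = 1) ->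
  all (fun c => uniq (c.1 ++ c.2) && (c.1 != [::])) cells ->
  (forall v : nat -> 'rV[R]_5, general_position v n ->
     has (fun c => crosses v c.1 c.2) cells) ->
  exists2 c, c \in cells & touching p c.1 c.2.
Proof.
move=> p1 cells_ok crossing; apply: contrapT => none.
have [P P0 gp] := generic_poly p n.
have near_no : \forall e \near (0 : R), {in cells, forall c,
    ~~ crosses (segment_conf p (moment_point R) e) c.1 c.2}.
  apply: (@near_all_seq _ _ (nbhs (0 : R)) _ _ (fun c e =>
    ~~ crosses (segment_conf p (moment_point R) e) c.1 c.2)) => c cin.
  have /andP[uc c0] := allP cells_ok c cin.
  apply: not_touching_near => //.
    by move=> i; rewrite mxE expr0.
  by move=> tch; apply: none; exists c.
have [e no nz] := near0_nonroot P0 near_no.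
by have /hasP[c /no/negP] := crossing _ (gp e nz).
Qed.

Theorem theorem3p2 (R : realType) (A : 'I_5 -> 'I_5 -> 'rV[R]_4)
    (A_distinct : injective2 A) :
  exists V W : set 'rV[R]_4,
    [/\ mn_product A V, mn_product A W,
        V `&` W = set0 & (convex_hull V `&` convex_hull W) !=set0].
Proof.
pose x i := A (inord (i %/ 5)) (inord (i %% 5)).
have cells_ok : all (fun c => uniq (c.1 ++ c.2) && (c.1 != [::])) product_cells.
  by vm_compute.
have [c cin tch] := touching_of_generic_crossing
  (fun i => homogenize0 (x i)) cells_ok (@product_crossing R).
have /allP/(_ c cin)/and4P[tri1 tri2 uc lt25] : all (fun c =>
    [&& product_triangle c.1, product_triangle c.2, uniq (c.1 ++ c.2)
      & all (gtn 25) (c.1 ++ c.2)]) product_cells by vm_compute.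
exists (vertex_set x c.1), (vertex_set x c.2); split.
- exact: product_triangleP.
- exact: product_triangleP.
- apply/seteqP; split=> // y [[i /= i1 <-] [j /= j2]].
  have lt5 k : k \in c.1 ++ c.2 -> (k %/ 5 < 5)%N.
    by move=> /(allP lt25) /=; rewrite ltn_divLR.
  have i5 : (i %/ 5 < 5)%N by apply: lt5; rewrite mem_cat i1.
  have j5 : (j %/ 5 < 5)%N by apply: lt5; rewrite mem_cat j2 orbT.
  case/A_distinct => /(congr1 val) /= + /(congr1 val) /=.
  rewrite !inordK ?ltn_mod // => ijd ijm.
  have ij : i = j by rewrite (divn_eq i 5) (divn_eq j 5) ijd ijm.
  by move: uc; rewrite cat_uniq => /and3P[_ /hasP[]]; exists j; rewrite // -ij.
- exact: touching_hulls.
Qed.
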